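(* Let $k$ be a field, let $R=k[x_1,\ldots,x_n]$, and let $\Delta$ be a simplicial tree whose vertices are among $x_1,\ldots,x_n$, with facet ideal $\mathcal{F}(\Delta)\subseteq R$. If $\Delta$ is Cohen-Macaulay, i.e. $R/\mathcal{F}(\Delta)$ is a Cohen-Macaulay ring, then the nonface (Stanley-Reisner) complex $\Delta_N$ of $\mathcal{F}(\Delta)$ is shellable.
   Context: A simplicial complex is a collection of subsets (faces) of a finite set, closed under taking subsets and containing the empty set; its vertices are the elements $v$ with $\{v\}$ a face, and its facets are its maximal faces. A complex $\Delta$ whose facet ideal is taken has at least one vertex. A subcollection of $\Delta$ is a simplicial complex whose set of facets is a subset of the set of facets of $\Delta$. Vertices are identified with variables. The facet ideal $\mathcal{F}(\Delta)\subseteq R$ is the ideal generated by the square-free monomials $\prod_{x\in F}x$, where $F$ ranges over the facets of $\Delta$. The nonface complex $\Delta_N$ of $\mathcal{F}(\Delta)$ is the simplicial complex on $\{x_1,\ldots,x_n\}$ in which a subset $\{x_{i_1},\ldots,x_{i_s}\}$ is a face if and only if $x_{i_1}\cdots x_{i_s}\notin\mathcal{F}(\Delta)$ (not every $x_i$ need be a vertex of $\Delta_N$). $\Delta$ is connected if for any two facets $F,F'$ there is a sequence of facets starting at $F$ and ending at $F'$ in which consecutive facets have nonempty intersection. A facet $F$ of $\Delta$ is a leaf if either $F$ is the only facet of $\Delta$, or there is a facet $G\neq F$ of $\Delta$ such that $F\cap F'\subseteq G$ for every facet $F'\ne F$ of $\Delta$. A tree is a connected simplicial complex every nonempty subcollection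 of which has a leaf. Shellable has the usual (pure) meaning: a simplicial complex is shellable if all its facets have the same dimension and its facets can be ordered $H_1,\ldots,H_m$ so that for every $2\le i\le m$ the complex $\langle H_i\rangle\cap\langle H_1,\ldots,H_{i-1}\rangle$ is generated by a nonempty set of maximal proper faces of $H_i$, where $\langle H_1,\ldots,H_j\rangle$ denotes the complex of all subsets of the sets $H_1,\ldots,H_j$. *)

(* Defs.v *)
From HB Require Import structures.
From mathcomp Require Import all_boot all_order all_algebra.
From mathcomp Require Import boolp.
From mathcomp Require Import mpoly.

Set Implicit Arguments.
Unset Strict Implicit.
Unset Printing Implicit Defensive.

Import GRing.Theory.
Local Open Scope ring_scope.

Section SimplicialComplexes.

Variable V : finType.
Implicit Types (D S : {set {set V}}) (F G H : {set V}).

Definition simplicial_complex D : Prop :=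
  set0 \in D /\ (forall F G, F \in D -> G \subset F -> G \in D).

(* Elements of [V] need not be vertices of a complex on [V]. *)
Definition is_vertex D (v : V) : bool := [set v] \in D.

Definition has_vertex D : Prop := exists v, is_vertex D v.

Definition facets D : {set {set V}} :=
  [set F | maxset (fun G => G \in D) F].

Definition subcollection S D : Prop :=
  simplicial_complex S /\ facets S \subset facets D.

Definition facet_adj D : rel {set V} :=
  fun F G => [&& F \in facets D, G \in facets D & F :&: G != set0].

Definition connected D : Prop :=
  forall F G, F \in facets D -> G \in facets D -> connect (facet_adj D) F G.

Definition leaf D F : Prop :=
  F \in facets D /\
  (facets D = [set F] \/
   exists G, [/\ G \in facets D, G != F &
     forall F', F' \in facets D -> F' != F -> F :&: F' \subset G]).

Definition simplicial_tree D : Prop :=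
  [/\ simplicial_complex D, connected D &
      forall S, subcollection S D -> facets S != set0 -> exists F, leaf S F].

Definition complex_gen S : {set {set V}} :=
  [set G : {set V} | [exists F in S, G \subset F]].

Definition max_proper_faces H : {set {set V}} :=
  [set G : {set V} | maxset (fun G' : {set V} => G' \proper H) G].

Definition shellable D : Prop :=
  (forall F G, F \in facets D -> G \in facets D -> #|F| = #|G|) /\
  exists s : seq {set V},
    [/\ uniq s, s =i facets D &
        forall i, (0 < i < size s)%N ->
          exists S, [/\ S != set0, S \subset max_proper_faces (nth set0 s i) &
            complex_gen [set nth set0 s i] :&: complex_gen [set:: take i s]
              = complex_gen S]].

End SimplicialComplexes.

Section CohenMacaulay.

Variable A : comNzRingType.

Definition ideal_gen (s : seq A) : {pred A} :=
  fun x => `[< exists c : 'I_(size s) -> A, x = \sum_i c i * s`_i >].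

(* [idealr A] consists of the proper ideals; the unit ideal is generated
   by 1. *)
Definition noetherian : Prop :=
  forall J : idealr A, exists s : seq A, J =i ideal_gen s.

Definition maximal_ideal (P : idealr A) : Prop :=
  forall J : idealr A, {subset P <= J} -> {subset J <= P}.

Definition regular_seq (s : seq A) : Prop :=
  1 \notin ideal_gen s /\
  forall i, (i < size s)%N -> forall y,
    s`_i * y \in ideal_gen (take i s) -> y \in ideal_gen (take i s).

Definition regular_seq_in (P : {pred A}) (d : nat) : Prop :=
  exists s : seq A, [/\ size s = d, {subset s <= P} & regular_seq s].

Definition depth_is (P : {pred A}) (d : nat) : Prop :=
  regular_seq_in P d /\ forall e, regular_seq_in P e -> (e <= d)%N.

(* A strictly increasing chain of primes c 0 < ... < c d = P; the values of c
   beyond d are irrelevant. *)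
Definition prime_chain_to (P : {pred A}) (d : nat) : Prop :=
  exists c : nat -> prime_idealr A,
    (forall i, (i < d)%N ->
       {subset c i <= c i.+1} /\ ~ {subset c i.+1 <= c i}) /\
    c d =i P.

Definition height_is (P : {pred A}) (d : nat) : Prop :=
  prime_chain_to P d /\ forall e, prime_chain_to P e -> (e <= d)%N.

(* Definition of Eisenbud, Commutative Algebra, Section 18.2: the depth of
   every maximal ideal equals its height. In a Noetherian ring both numbers
   are finite. *)
Definition cohen_macaulay : Prop :=
  noetherian /\
  forall P : idealr A, maximal_ideal P ->
    exists d, depth_is P d /\ height_is P d.

End CohenMacaulay.

Section FacetIdeal.

Variables (k : fieldType) (n : nat).
Implicit Types (D : {set {set 'I_n}}) (F : {set 'I_n}).

Definition face_monomial F : {mpoly k[n]} := \prod_(i in F) 'X_i.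

Definition facet_ideal D : {pred {mpoly k[n]}} :=
  ideal_gen [seq face_monomial F | F <- enum (facets D)].

Definition nonface_complex (I : {pred {mpoly k[n]}}) : {set {set 'I_n}} :=
  [set F | face_monomial F \notin I].

Lemma facet_ideal_closed D : has_vertex D -> idealr_closed (facet_ideal D).
Proof.
move=> [v vD]; rewrite /facet_ideal; set s := map _ _; split.
- apply/asboolP; exists (fun=> 0).
  by rewrite big1 // => i _; rewrite mul0r.
- apply/negP => /asboolP[c /(congr1 (meval (fun=> 0)))].
  rewrite meval1 raddf_sum big1 => [/eqP|i _]; first by rewrite oner_eq0.
  rewrite /= mevalM.
  have /mapP[F] : s`_i \in s by rewrite mem_nth.
  rewrite mem_enum inE => /maxsetP[_ maxF] ->.
  have [F0|[w wF]] := set_0Vmem F.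
    have := maxF _ vD; rewrite F0 sub0set => /(_ isT)/setP/(_ v).
    by rewrite !inE eqxx.
  by rewrite /face_monomial (bigD1 w) //= mevalM mevalXU mul0r mulr0.
- move=> a x y /asboolP[c ->] /asboolP[d ->]; apply/asboolP.
  exists (fun i => a * c i + d i); rewrite mulr_sumr -big_split /=.
  by apply: eq_bigr => i _; rewrite mulrDl mulrA.
Qed.

Definition facet_idealr D (hv : has_vertex D) : idealr {mpoly k[n]} :=
  HB.pack (facet_ideal D : {mpoly k[n]} -> bool)
    (isIdealr.Build {mpoly k[n]} (facet_ideal D) (facet_ideal_closed hv)).

Definition facet_ring D (hv : has_vertex D) : comNzRingType :=
  {ideal_quot (facet_idealr hv)}.

End FacetIdeal.

Arguments face_monomial k {n} F.
Arguments facet_ideal k {n} D.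
Arguments facet_idealr k {n D} hv.
Arguments facet_ring k {n D} hv.

(* Main.v *)
Require Import Defs.
From HB Require Import structures.
From mathcomp Require Import all_boot all_order all_algebra.
From mathcomp Require Import generic_quotient ring_quotient boolp ring.
From mathcomp Require Import mpoly.

(** The facets of the nonface complex are the maximal sets of variables that
contain no facet of the tree; their complements are the minimal vertex covers.
The theorem has a combinatorial half, which uses only the leaves of the tree,
and an algebraic half, which uses only the Cohen-Macaulay property.

Combinatorial half: for a simplicial tree the facets of the nonface complex can
be listed so that for i < j some k < j and some v in H_j outside H_i satisfy
H_j \ H_k = {v} ([leafy_shelling]); this is shellability except that the facets
may have different sizes. Call a family of sets leafy when each nonempty
subfamily has a leaf. Leafiness passes to subfamilies and to contractions
F |-> F \ A, and a leafy antichain has a vertex x that lies in only one member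
F, because a leaf is not contained in its joint. The facets through x are those
for the contraction of x. The facets missing x contain F \ {x}; they come, by
deleting x, from the facets for the family without F contracted along F \ {x}.
Both families have fewer vertices, so by induction each part can be listed, and
the first list followed by the second works: a facet H missing x is related to
the facets through x by trading a vertex of F \ {x} for x
([shelling_exchange]).

Algebraic half: if A = k[x_1..x_n]/I is Cohen-Macaulay, all facets of the
nonface complex have the same size ([cohen_macaulay_pure]). Let P be the image
of (x_1, ..., x_n) and d its depth, which is also its height. Each facet H
gives a chain of primes generated by variables, of length #|H|, that ends at P,
so #|H| <= d. Conversely, let f_1, ..., f_d in P be a regular sequence and u the
monomial of H. No element outside P kills u, and this forces the power products
of the f_i, multiplied by u, to be linearly independent over k
([regular_power_products_free]). The annihilator of u contains every polynomial
that vanishes when the variables outside H are set to zero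
([killed_annihilated]), so the f_i remain algebraically independent in a
polynomial ring in #|H| variables, and counting monomials of bounded degree
gives d <= #|H| ([power_products_dependent]). Hence #|H| = d for every facet.
*)

Set Implicit Arguments.
Unset Strict Implicit.
Unset Printing Implicit Defensive.

(** * Leafy families and shellings of their independence complexes *)

Section Combinatorics.

Variable V : finType.
Implicit Types (D E S : {set {set V}}) (A F G H K : {set V}).

Definition is_leaf_of S F : Prop :=
  S = [set F] \/
  exists G, [/\ G \in S, G != F &
    forall F', F' \in S -> F' != F -> F :&: F' \subset G].

(** The combinatorial content of being a simplicial forest, kept for arbitrary
families: contracting a family need not give an antichain, so facets of a
complex would be too restrictive. *)
Definition leafy E : Prop :=
  forall S, S \subset E -> S != set0 -> exists2 F, F \in S & is_leaf_of S F.

Definition independent E : {set {set V}} :=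
  [set H : {set V} | [forall F in E, ~~ (F \subset H)]].

Definition contract A E : {set {set V}} := [set F :\: A | F in E].

Definition antichain E : Prop :=
  forall F G, F \in E -> G \in E -> F \subset G -> F = G.

Lemma leafyS E S : S \subset E -> leafy E -> leafy S.
Proof. by move=> sSE lE T sTS; apply: lE; apply: subset_trans sSE. Qed.

(** Lifting each contracted set to one set that contracts to it turns a subfamily
of the contraction into a subfamily of the original; a leaf and its joint
upstairs then contract to a leaf and a joint. *)
Lemma leafy_contract A E : leafy E -> leafy (contract A E).
Proof.
move=> lE S sSE S0.
pose lift X := odflt X [pick F in E | F :\: A == X].
have liftP X : X \in S -> lift X \in E /\ lift X :\: A = X.
  move=> /(subsetP sSE)/imsetP[F FE ->]; rewrite /lift.
  case: pickP => [G /andP[GE /eqP->] //|/(_ F)].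
  by rewrite FE eqxx.
have [||F0 F0S leafF] := lE (lift @: S).
- by apply/subsetP=> _ /imsetP[X /liftP[? _] ->].
- by have [X XS] := set0Pn _ S0; apply/set0Pn; exists (lift X); apply: imset_f.
have {F0S} [X XS defF] := imsetP F0S; subst F0.
exists X => //; case: leafF => [defS|[_ [/imsetP[Y YS ->] neYX jointY]]].
  left; apply/setP=> Y; rewrite inE; apply/idP/eqP=> [YS|-> //].
  have: lift Y \in lift @: S by apply: imset_f.
  rewrite defS inE => /eqP eqXY.
  by rewrite -(liftP _ YS).2 eqXY (liftP _ XS).2.
right; exists Y; split=> // [|Z ZS neZX].
  by apply: contraNneq neYX => ->.
have neL : lift Z != lift X.
  by apply: contraNneq neZX => eqZX; rewrite -(liftP _ ZS).2 eqZX (liftP _ XS).2.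
have := setSD A (jointY _ (imset_f _ ZS) neL).
by rewrite setDIl (liftP _ XS).2 (liftP _ YS).2 (liftP _ ZS).2.
Qed.

(** A vertex of the leaf outside its joint is in no other member, since the leaf
meets every other member inside the joint. *)
Lemma free_vertex E :
    leafy E -> antichain E -> E != set0 -> set0 \notin E ->
  exists x F, [/\ F \in E, x \in F & forall F', F' \in E -> x \in F' -> F' = F].
Proof.
move=> lE acE E0 nE0; have [F FE [defE|[G [GE neGF joint]]]] := lE E (subxx _) E0.
  have [F0|[x xF]] := set_0Vmem F; first by rewrite -F0 FE in nE0.
  by exists x, F; split=> // F'; rewrite defE inE => /eqP.
have /subsetPn[x xF xnG] : ~~ (F \subset G).
  by apply: contraNN neGF => /(acE _ _ FE GE) ->.
exists x, F; split=> // F' F'E xF'; apply/eqP/negPn/negP=> neF'F.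
by have /subsetP/(_ x) := joint F' F'E neF'F; rewrite inE xF xF' (negPf xnG) => /(_ isT).
Qed.

Lemma independentP E H :
  reflect (forall F, F \in E -> ~ F \subset H) (H \in independent E).
Proof.
rewrite inE; apply: (iffP forallP) => [iH F FE|iH F].
  by have /implyP/(_ FE)/negP := iH F.
by apply/implyP=> FE; apply/negP/iH.
Qed.

Lemma facets_independentP E H :
  reflect ((forall F, F \in E -> ~ F \subset H) /\
           (forall y, y \notin H -> exists2 F, F \in E & F \subset y |: H))
          (H \in facets (independent E)).
Proof.
rewrite inE; apply: (iffP maxsetP) => [[/independentP iH maxH]|[iH maxH]].
  split=> // y ynH; have [/existsP[F /andP[]]|] := boolP [exists F in E, F \subset y |: H].
    by exists F.
  move/existsPn=> iyH; case/negP: ynH; rewrite -(maxH (y |: H)) ?setU11 ?subsetUr //.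
  by apply/independentP=> F FE sF; have := iyH F; rewrite FE sF.
split; first exact/independentP.
move=> G /independentP iG sHG; apply/eqP; rewrite eqEsubset sHG andbT.
apply/subsetP=> y yG; apply: contraT => /maxH[F FE sF].
by case: (iG F FE); apply: subset_trans sF _; rewrite subUset sub1set yG.
Qed.

Lemma facets_independent_cover E H x :
  H \in facets (independent E) -> x \notin cover E -> x \in H.
Proof.
move=> /facets_independentP[iH maxH] xnE; apply: contraT => /maxH[F FE sF].
case: (iH F FE); apply/subsetP=> y yF; have := subsetP sF y yF.
rewrite !inE => /orP[/eqP eyx|//]; case/negP: xnE.
by apply/bigcupP; exists F; rewrite // -eyx.
Qed.

(** The members of a contraction avoid [A], so its maximal independent sets all
contain [A]; on sets that contain [A] the two conditions of independence
agree. *)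
Lemma facets_contract A E H :
  (H \in facets (independent (contract A E))) =
  (A \subset H) && (H \in facets (independent E)).
Proof.
have sub_contract F G : A \subset G -> (F :\: A \subset G) = (F \subset G).
  by move=> sAG; rewrite subDset; move/setUidPr: sAG => ->.
have eqH : A \subset H -> (H \in facets (independent (contract A E))) =
    (H \in facets (independent E)).
  move=> sAH; have sAyH y : A \subset y |: H by rewrite (subset_trans sAH) ?subsetUr.
  apply/facets_independentP/facets_independentP => -[iH maxH]; split.
  - by move=> F FE; rewrite -(sub_contract F H sAH); apply: iH; apply: imset_f.
  - move=> y /maxH[_ /imsetP[F FE ->]]; rewrite sub_contract //; by exists F.
  - by move=> _ /imsetP[F FE ->]; rewrite sub_contract //; apply: iH.
  - move=> y /maxH[F FE sF]; exists (F :\: A); first exact: imset_f.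
    by rewrite sub_contract.
case: (boolP (A \subset H)) => [/eqH // | nsAH].
apply: contraNF nsAH => /facets_independent_cover inH; apply/subsetP=> x xA.
apply: inH; apply/bigcupP=> -[_ /imsetP[F _ ->]].
by rewrite inE xA.
Qed.

(** Adding [x] to a maximal independent set that misses it must complete a member
through [x], and [F] is the only one. *)
Lemma free_edge_sub_facet E F x H :
    (forall F', F' \in E -> x \in F' -> F' = F) ->
    H \in facets (independent E) -> x \notin H -> F :\ x \subset H.
Proof.
move=> freex /facets_independentP[iH maxH] xnH.
have [F' F'E sF'] := maxH x xnH; have [xF'|xnF'] := boolP (x \in F').
  by rewrite subDset -(freex F' F'E xF').
by case: (iH F' F'E); rewrite -(setU1K xnH) subsetD1 sF'.
Qed.

(** Once [F] is removed from the family, [x] is in no member, so it is in every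
facet of the smaller complex; deleting it restores the condition imposed by
[F]. *)
Lemma facets_missing_free_vertex E F x H :
    F \in E -> x \in F -> (forall F', F' \in E -> x \in F' -> F' = F) ->
  (H \in facets (independent E)) && (x \notin H) =
  (H \in [set K :\ x | K in facets (independent (contract (F :\ x) (E :\ F)))]).
Proof.
move=> FE xF freex; have avoidx := free_edge_sub_facet freex.
have xnF' F' : F' \in E :\ F -> x \notin F'.
  rewrite !inE => /andP[neF F'E]; apply: contraNN neF => /(freex _ F'E) -> //.
apply/andP/imsetP => [[facetH xnH]|[K]].
  exists (x |: H); last by rewrite setU1K.
  have sFH := avoidx H facetH xnH.
  have [iH maxH] := facets_independentP _ _ facetH.
  rewrite facets_contract (subset_trans sFH) ?subsetUr //=.
  apply/facets_independentP; split=> [F' F'E sF'|y].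
    have xnF'1 := xnF' _ F'E; move: F'E; rewrite inE => /andP[_ F'E].
    by case: (iH F' F'E); rewrite -(setU1K xnH) subsetD1 sF'.
  rewrite !inE negb_or => /andP[neyx ynH]; have [F' F'E sF'] := maxH y ynH.
  exists F'; last by apply: subset_trans sF' _; rewrite setUCA subsetUr.
  rewrite !inE F'E andbT; apply: contraTneq sF' => ->.
  by apply/subsetPn; exists x; rewrite // !inE negb_or eq_sym neyx.
rewrite facets_contract => /andP[sFK facetK] ->; split; last by rewrite !inE eqxx.
have xK : x \in K.
  apply: facets_independent_cover facetK _; apply/bigcupP=> -[F' F'E].
  by apply/negP/xnF'.
have [iK maxK] := facets_independentP _ _ facetK.
apply/facets_independentP; split=> [F' F'E|y].
  have [->|neF'] := eqVneq F' F.
    by move/subsetP/(_ x xF); rewrite !inE eqxx.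
  move=> sF'; apply: (iK F'); first by rewrite !inE neF'.
  exact: subset_trans sF' (subD1set _ _).
rewrite !inE negb_and negbK => /orP[/eqP ->|ynK].
  exists F => //; rewrite setD1K.
    by rewrite -(setD1K xF) subUset sub1set xK.
  exact: xK.
have [F' F'E sF'] := maxK y ynK; have xnF'1 := xnF' _ F'E.
exists F'; first by move: F'E; rewrite inE => /andP[].
apply/subsetP=> z zF'; have := subsetP sF' z zF'; rewrite !inE => /orP[->//|->].
by rewrite andbT (contraTneq _ zF') ?orbT // => ->.
Qed.

(** The set [G :&: H] lies in [H :\ v], which is [H :&: K]: the intersection of
[H] with the earlier sets is generated by sets [H :\ v]. Sizes are not compared,
so that the notion passes to the two halves of the induction. *)
Definition shelling_step (s : seq {set V}) H : Prop :=
  forall G, G \in s ->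
    exists v K, [/\ K \in s, v \in H, v \notin G & H :\: K = [set v]].

Definition shelling (s : seq {set V}) : Prop :=
  forall i, (i < size s)%N -> shelling_step (take i s) (nth set0 s i).

Lemma shelling_cat s1 s2 :
    shelling s1 -> shelling s2 ->
    (forall H, H \in s2 -> shelling_step s1 H) ->
  shelling (s1 ++ s2).
Proof.
move=> sh1 sh2 cross i; rewrite size_cat take_cat nth_cat.
case: (ltnP i (size s1)) => [lti1 _ | le1i lti]; first exact: sh1.
have lt2 : (i - size s1 < size s2)%N by rewrite ltn_subLR.
move=> G; rewrite mem_cat => /orP[Gs1|Gs2].
  have [v [K [Ks ? ? ?]]] := cross _ (mem_nth set0 lt2) _ Gs1.
  by exists v, K; split; rewrite // mem_cat Ks.
have [v [K [Ks ? ? ?]]] := sh2 _ lt2 _ Gs2.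
by exists v, K; split; rewrite // mem_cat Ks orbT.
Qed.

Lemma shelling_delete x s :
  (forall H, H \in s -> x \in H) -> shelling s -> shelling [seq H :\ x | H <- s].
Proof.
move=> xs sh i; rewrite size_map => lti; rewrite (nth_map set0) // -map_take.
move=> _ /mapP[G Gs ->]; have [v [K [Ks vH vG defv]]] := sh i lti _ Gs.
have nevx : v != x by apply: contraNneq vG => ->; apply/xs/(mem_take Gs).
exists v, (K :\ x); split; rewrite ?inE ?nevx ?vH ?(negPf vG) //.
  exact: (map_f (fun H => H :\ x)).
apply/setP=> y; rewrite -defv !inE; case: eqVneq => //= ->.
by rewrite (xs _ (mem_take Ks)).
Qed.

Lemma exists_facet D F : F \in D -> exists2 G, G \in facets D & F \subset G.
Proof.
move=> FD; have [G maxG sFG] := maxset_exists (P := fun G => G \in D) FD.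
by exists G; rewrite // inE.
Qed.

(** Some [v] of [F] is missing from [G]. Trading [v] for [x] in [H] keeps
independence, because [x] is only in [F], which contains [v]; a facet [K] that
extends the result cannot contain [v], since it would contain [F]. *)
Lemma shelling_exchange E F x H G :
    F \in E -> x \in F -> (forall F', F' \in E -> x \in F' -> F' = F) ->
    H \in facets (independent E) -> x \notin H ->
    G \in facets (independent E) -> x \in G ->
  exists v K, [/\ K \in facets (independent E), x \in K, v \in H, v \notin G &
                  H :\: K = [set v]].
Proof.
move=> FE xF freex facetH xnH /facets_independentP[iG _] xG.
have /subsetPn[v vF vnG] : ~~ (F \subset G) by apply/negP/iG.
have nevx : v != x by apply: contraNneq vnG => ->.
have [iH _] := facets_independentP _ _ facetH.
have sFH K : K \in facets (independent E) -> x \notin K -> F :\ x \subset K.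
  exact: free_edge_sub_facet.
have vH : v \in H.
  by have /subsetP := sFH H facetH xnH; apply; rewrite !inE nevx.
have [|K facetK sK] := @exists_facet (independent E) (x |: H :\ v).
  apply/independentP=> F' F'E sF'; have [xF'|xnF'] := boolP (x \in F').
    have := subsetP sF' v; rewrite (freex F' F'E xF') vF !inE (negPf nevx) eqxx.
    by move/(_ isT).
  case: (iH F' F'E); apply/subsetP=> z zF'; have := subsetP sF' z zF'.
  by rewrite !inE => /orP[/eqP ezx|/andP[_ //]]; rewrite -ezx zF' in xnF'.
have xK : x \in K by apply: (subsetP sK); rewrite setU11.
have vnK : v \notin K.
  apply/negP=> vK; have [iK _] := facets_independentP _ _ facetK.
  apply: (iK F FE); rewrite -(setD1K xF) subUset sub1set xK.
  apply: subset_trans (sFH H facetH xnH) _; rewrite -(setD1K vH) subUset sub1set vK.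
  by apply: subset_trans sK; apply: subsetUr.
exists v, K; split=> //; apply/setP=> y; rewrite !inE.
apply/andP/eqP=> [[ynK yH]|->//]; apply: contraNeq ynK => neyv.
by apply: (subsetP sK); rewrite !inE neyv yH orbT.
Qed.

Lemma cover_contract A E : cover (contract A E) = cover E :\: A.
Proof.
apply/setP=> y; rewrite inE; apply/bigcupP/andP=> [[_ /imsetP[F FE ->]]|[ynA]].
  by rewrite inE => /andP[-> yF]; split=> //; apply/bigcupP; exists F.
case/bigcupP=> F FE yF; exists (F :\: A); first exact: imset_f.
by rewrite inE ynA.
Qed.

Definition minimal_members E := [set F in E | minset (fun G => G \in E) F].

Lemma independent_minimal E : independent (minimal_members E) = independent E.
Proof.
apply/setP=> H; apply/independentP/independentP=> iH F; last first.
  by rewrite inE => /andP[FE _]; apply: iH.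
move=> FE sFH; have [G minG sGF] := minset_exists (P := fun G => G \in E) FE.
case: (iH G); last exact: subset_trans sFH.
by rewrite inE minG andbT; have [] := minsetP minG.
Qed.

Lemma antichain_minimal E : antichain (minimal_members E).
Proof.
move=> F G; rewrite !inE => /andP[FE _] /andP[_ /minsetP[_ minG]].
exact: minG.
Qed.

(** Induction on the number of vertices covered. Passing to the minimal members
changes neither the complex nor leafiness and provides a free vertex. *)
Lemma leafy_shelling E : leafy E ->
  exists s, [/\ uniq s, s =i facets (independent E) & shelling s].
Proof.
have [m] := ubnP #|cover E|; elim: m E => // m IHm E0 ltEm lE0.
rewrite -independent_minimal; set E := minimal_members E0.
have sEE0 : E \subset E0 by apply/subsetP=> F; rewrite inE => /andP[].
have {lE0} lE : leafy E by apply: leafyS lE0.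
have acE : antichain E by apply: antichain_minimal.
have {ltEm} leEm : (#|cover E| <= m)%N.
  rewrite ltnS in ltEm; apply: leq_trans ltEm; apply: subset_leq_card.
  apply/subsetP=> y /bigcupP[F FE yF]; apply/bigcupP; exists F => //.
  exact: (subsetP sEE0).
(* If the empty set is a member, nothing is independent. *)
have [nilE|nE0] := boolP (set0 \in E).
  exists [::]; split=> // H; rewrite in_nil; apply/esym/negP.
  by case/facets_independentP=> /(_ _ nilE); rewrite sub0set.
have [E_0|Ene] := eqVneq E set0.
  exists [:: setT]; split=> [//|H|[|//] _ G]; last by rewrite in_nil.
  rewrite inE E_0; apply/eqP/facets_independentP => [->|[_ maxH]].
    by split=> [F|y]; rewrite inE.
  by apply/setP=> y; rewrite inE; apply: contraT => /maxH[F]; rewrite inE.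
have [x [F [FE xF freex]]] := free_vertex lE acE Ene nE0.
have xE : x \in cover E by apply/bigcupP; exists F.
have [||s1 [us1 ms1 sh1]] := IHm (contract [set x] E).
- by rewrite cover_contract; move: leEm; rewrite (cardsD1 x) xE.
- exact: leafy_contract.
have [||s2 [us2 ms2 sh2]] := IHm (contract (F :\ x) (E :\ F)).
- rewrite cover_contract; apply: leq_trans leEm; apply: proper_card.
  apply/properP; split; last first.
    exists x => //; rewrite inE negb_and; apply/orP; right.
    apply/bigcupP=> -[F' /setD1P[neF' F'E] /(freex _ F'E) eqF'].
    by rewrite eqF' eqxx in neF'.
  apply: subset_trans (subsetDl _ _) _; apply/subsetP=> y /bigcupP[F' /setD1P[_ F'E] yF'].
  by apply/bigcupP; exists F'.
- by apply: leafy_contract; apply: leafyS lE; apply: subD1set.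
have xs2 K : K \in s2 -> x \in K.
  rewrite ms2 => /facets_independent_cover; apply; rewrite cover_contract inE negb_and.
  apply/orP; right; apply/bigcupP=> -[F' /setD1P[neF' F'E] /(freex _ F'E) eqF'].
  by rewrite eqF' eqxx in neF'.
have ms1' H : (H \in s1) = (x \in H) && (H \in facets (independent E)).
  by rewrite ms1 facets_contract sub1set.
have ms2' H : (H \in [seq K :\ x | K <- s2]) = (H \in facets (independent E)) && (x \notin H).
  rewrite (facets_missing_free_vertex H FE xF freex).
  apply/mapP/imsetP=> -[K Ks ->]; exists K => //; first by rewrite -ms2.
  by rewrite ms2.
exists (s1 ++ [seq K :\ x | K <- s2]); split.
- rewrite cat_uniq us1 map_inj_in_uniq ?us2 ?andbT.
    by apply/hasPn=> H; rewrite ms2' ms1' => /andP[_ /negPf ->].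
  by move=> K K' /xs2 xK /xs2 xK' eqK; rewrite -(setD1K xK) eqK setD1K.
- move=> H; rewrite mem_cat ms1' ms2'; by case: (x \in H); rewrite ?andbT ?andbF ?orbF.
- apply: shelling_cat => //; first exact: shelling_delete.
  move=> H; rewrite ms2' => /andP[facetH xnH] G; rewrite ms1' => /andP[xG facetG].
  have [v [K [facetK xK vH vG defv]]] := shelling_exchange FE xF freex facetH xnH facetG xG.
  by exists v, K; rewrite ms1' xK.
Qed.

Lemma shellable_of_shelling D s :
    (forall F G, F \in facets D -> G \in facets D -> #|F| = #|G|) ->
    uniq s -> s =i facets D -> shelling s -> shellable D.
Proof.
move=> pureD us ms sh; split=> //; exists s; split=> // i /andP[i0 lti].
set H := nth set0 s i; set t := take i s.
exists [set H :\ v | v in H & [exists K in t, H :\: K == [set v]]].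
have szt : size t = i by rewrite size_take lti.
split.
- have Gt : nth set0 t 0 \in t by rewrite mem_nth ?szt.
  have [v [K [Kt vH _ defv]]] := sh i lti _ Gt.
  apply/set0Pn; exists (H :\ v); apply: imset_f; rewrite inE vH /=.
  by apply/exists_inP; exists K; rewrite ?defv.
- apply/subsetP=> _ /imsetP[v /setIdP[vH _] ->]; rewrite inE; apply/maxsetP.
  split=> [|G prG sG]; first exact: properD1.
  apply/eqP; rewrite eqEsubset sG andbT subsetD1 proper_sub //.
  apply: contraTN prG => vG; rewrite properE negb_and; apply/orP; right.
  by rewrite negbK -(setD1K vH) subUset sub1set vG sG.
- apply/setP=> G; rewrite !inE; apply/andP/exists_inP.
    case=> /exists_inP[_ /set1P-> sGH] /exists_inP[G' ]; rewrite inE => G't sGG'.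
    have [v [K [Kt vH vG' defv]]] := sh i lti _ G't.
    exists (H :\ v).
      apply: imset_f; rewrite inE vH /=; apply/exists_inP.
      by exists K; rewrite ?defv.
    rewrite subsetD1 sGH; apply: contraNN vG'; exact: (subsetP sGG').
  case=> _ /imsetP[v /setIdP[vH /exists_inP[K Kt /eqP defv]] ->] sG; split.
    apply/exists_inP; exists H; rewrite ?inE //; apply: subset_trans sG _.
    exact: subD1set.
  apply/exists_inP; exists K; rewrite ?inE //; apply: subset_trans sG _.
  by rewrite -defv setDDr setDv set0U subsetIr.
Qed.

(** Facets form an antichain, so every nonempty set of facets of a tree is the set
of all facets of the subcollection that it generates. *)
Lemma leafy_facets D : simplicial_tree D -> leafy (facets D).
Proof.
move=> [[D0 Ddown] _ leafD] S sSD S0.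
have acS F G : F \in S -> G \in S -> F \subset G -> F = G.
  move=> /(subsetP sSD); rewrite inE => /maxsetP[_ maxF].
  move=> /(subsetP sSD); rewrite inE => /maxsetP[GD _] sFG.
  exact/esym/maxF.
have facetsS : facets (complex_gen S) = S.
  apply/setP=> F; rewrite inE; apply/maxsetP/idP.
    rewrite inE => -[/exists_inP[G GS sFG] maxF]; rewrite -(maxF G) //.
    by rewrite inE; apply/exists_inP; exists G.
  move=> FS; split=> [|G]; first by rewrite inE; apply/exists_inP; exists F.
  rewrite inE => /exists_inP[F' F'S sGF'] sFG; apply/eqP; rewrite eqEsubset sFG andbT.
  by rewrite (acS F F') // (subset_trans sFG).
have [||F [FS leafF]] := leafD (complex_gen S).
- split; last by rewrite facetsS.
  split; first by have [F FS] := set0Pn _ S0; rewrite inE; apply/exists_inP; exists F; rewrite ?sub0set.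
  move=> F G; rewrite !inE => /exists_inP[H HS sFH] sGF; apply/exists_inP; exists H => //.
  exact: subset_trans sFH.
- by rewrite facetsS.
by rewrite facetsS in FS leafF; exists F.
Qed.

End Combinatorics.

(** * Regular sequences and linear independence of power products *)

Section RegularSequences.
Import GRing.Theory.
Local Open Scope ring_scope.

(** Exponent vectors of length [d] with entries below [N], as nested pairs so that
sums over them split off the first exponent. *)
Fixpoint exponents (N d : nat) : finType :=
  if d is d'.+1 then ('I_N * exponents N d')%type else unit.

(** The exponents have length [d] rather than [size s], so that mapping a
function over [s] does not change their type. *)
Fixpoint power_product (A : comNzRingType) N d (s : seq A) : exponents N d -> A :=
  if d is d'.+1 return exponents N d -> A
  then fun e => head 0 s ^+ e.1 * power_product (behead s) e.2
  else fun=> 1.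

Lemma rmorph_power_product (A B : comNzRingType) (phi : {rmorphism A -> B})
    N d (s : seq A) (e : exponents N d) :
  phi (power_product s e) = power_product (map phi s) e.
Proof.
elim: d s e => [|d IHd] s e /=; first exact: rmorph1.
by rewrite rmorphM rmorphXn IHd; case: s => //=; rewrite rmorph0.
Qed.

Section Ideals.

Variable A : comNzRingType.
Implicit Types (s t : seq A) (f x y a u w : A).

Lemma ideal_gen0 t : 0 \in ideal_gen t.
Proof. by apply/asboolP; exists (fun=> 0); rewrite big1 // => i _; rewrite mul0r. Qed.

Lemma ideal_genD t x y : x \in ideal_gen t -> y \in ideal_gen t -> x + y \in ideal_gen t.
Proof.
move=> /asboolP[c ->] /asboolP[d ->]; apply/asboolP; exists (fun i => c i + d i).
by rewrite -big_split; apply: eq_bigr => i _; rewrite mulrDl.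
Qed.

Lemma ideal_genM t a x : x \in ideal_gen t -> a * x \in ideal_gen t.
Proof.
move=> /asboolP[c ->]; apply/asboolP; exists (fun i => a * c i).
by rewrite mulr_sumr; apply: eq_bigr => i _; rewrite mulrA.
Qed.

Lemma ideal_genB t x y : x \in ideal_gen t -> y \in ideal_gen t -> x - y \in ideal_gen t.
Proof. by move=> xt yt; rewrite -mulN1r ideal_genD ?ideal_genM. Qed.

Lemma mem_ideal_gen t x : x \in t -> x \in ideal_gen t.
Proof.
move=> /(nthP 0)[i lti <-]; apply/asboolP; exists (fun j => (j == i :> nat)%:R).
rewrite (bigD1 (Ordinal lti)) //= eqxx mul1r big1 ?addr0 // => j.
by rewrite -val_eqE /= => /negPf ->; rewrite mul0r.
Qed.

Lemma ideal_gen_ind (Q : A -> Prop) t :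
    Q 0 -> (forall x y, Q x -> Q y -> Q (x + y)) ->
    (forall a x, x \in t -> Q (a * x)) ->
  forall x, x \in ideal_gen t -> Q x.
Proof.
move=> Q0 QD QM x /asboolP[c ->]; apply: big_ind => // i _.
by apply: QM; apply: mem_nth.
Qed.

Lemma ideal_gen_sub t s : {subset t <= ideal_gen s} -> {subset ideal_gen t <= ideal_gen s}.
Proof.
move=> sub; apply: ideal_gen_ind => [|x y|a x /sub]; first exact: ideal_gen0.
- exact: ideal_genD.
- exact: ideal_genM.
Qed.

Lemma ideal_gen_rconsl t f x : x \in ideal_gen t -> x \in ideal_gen (rcons t f).
Proof.
by apply: ideal_gen_sub => y yt; apply: mem_ideal_gen; rewrite mem_rcons inE yt orbT.
Qed.

Lemma ideal_gen_rcons t f x :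
  x \in ideal_gen (rcons t f) <-> exists a, x - a * f \in ideal_gen t.
Proof.
split=> [|[a]]; last first.
  move=> /(ideal_gen_rconsl f) xaf; rewrite -(subrK (a * f) x) ideal_genD //.
  by rewrite ideal_genM ?mem_ideal_gen ?mem_rcons ?mem_head.
move: x; apply: ideal_gen_ind => [|x y [a xa] [b yb]|b x].
- by exists 0; rewrite mul0r subr0 ideal_gen0.
- by exists (a + b); rewrite mulrDl opprD addrACA ideal_genD.
- rewrite mem_rcons inE => /orP[/eqP ->|xt].
    by exists b; rewrite subrr ideal_gen0.
  by exists 0; rewrite mul0r subr0 ideal_genM ?mem_ideal_gen.
Qed.

Variables (P : prime_idealr A) (noethA : noetherian A).

(** The image of [u] in the localization at [P] of the quotient by [t] is
nonzero. *)
Definition locally_nonzero t u : Prop :=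
  forall x, x \notin P -> x * u \notin ideal_gen t.

Lemma prime_notinM x y : x \notin P -> y \notin P -> x * y \notin P.
Proof. by move=> ? ?; rewrite prime_idealrM negb_or; apply/andP. Qed.

(** In the localization at [P], the annihilators of the powers of [f] modulo [t]
increase, hence stabilize: their union is an ideal, and its finitely many
generators need only a bounded power. *)
Lemma uniform_power t f : exists N, forall a r (x : A),
    x \notin P -> x * f ^+ r * a \in ideal_gen t ->
  exists2 y, y \notin P & y * f ^+ N * a \in ideal_gen t.
Proof.
have P1 : 1 \notin P by rewrite idealr1.
pose K a := `[< exists r x, x \notin P /\ x * f ^+ r * a \in ideal_gen t >].
(* The hypothesis on ideals speaks of proper ones, so the case where [K] is the
   unit ideal is separate. *)
have [K1|K1] := boolP (K 1).
  have [r [x [nPx xt]]] := asboolW K1; exists r => a _ _ _ _; exists x => //.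
  by rewrite -[x * _]mulr1 mulrC ideal_genM.
have idK : idealr_closed (K : {pred A}).
  split=> //; first by apply/asboolP; exists 0, 1; rewrite mulr0 ideal_gen0.
  move=> a u v /asboolP[r [x [nPx xu]]] /asboolP[q [y [nPy yv]]].
  apply/asboolP; exists (r + q)%N, (x * y); split; first exact: prime_notinM.
  have -> : x * y * f ^+ (r + q) * (a * u + v) =
      y * f ^+ q * a * (x * f ^+ r * u) + x * f ^+ r * (y * f ^+ q * v).
    by rewrite exprD; ring.
  by apply: ideal_genD; apply: ideal_genM.
pose KI : idealr A := HB.pack (K : A -> bool) (isIdealr.Build A K idK).
have [g defK] := noethA KI.
suff [N genN] : exists N, forall a, a \in g ->
    exists2 x, x \notin P & x * f ^+ N * a \in ideal_gen t.
  exists N => a r x nPx xa.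
  have: a \in ideal_gen g by rewrite -defK; apply/asboolP; exists r, x.
  move: a {r x nPx xa}; apply: ideal_gen_ind => [|u v [x nPx xu] [y nPy yv]|a u /genN[x nPx xu]].
  - by exists 1; rewrite // mulr0 ideal_gen0.
  - exists (x * y); first exact: prime_notinM.
    have -> : x * y * f ^+ N * (u + v) = y * (x * f ^+ N * u) + x * (y * f ^+ N * v) by ring.
    by apply: ideal_genD; apply: ideal_genM.
  - by exists x => //; rewrite mulrCA ideal_genM.
have: {subset g <= KI} by move=> a ag; rewrite defK mem_ideal_gen.
elim: g {defK} => [|a g IHg] gK; first by exists 0%N.
have [|N genN] := IHg; first by move=> b bg; apply: gK; rewrite inE bg orbT.
have /asboolP[r [x [nPx xa]]] := gK a (mem_head _ _).
exists (r + N)%N => b; rewrite inE exprD => /orP[/eqP ->|/genN[y nPy yb]].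
  exists x => //; have -> : x * (f ^+ r * f ^+ N) * a = f ^+ N * (x * f ^+ r * a) by ring.
  exact: ideal_genM.
exists y => //; have -> : y * (f ^+ r * f ^+ N) * b = f ^+ r * (y * f ^+ N * b) by ring.
exact: ideal_genM.
Qed.

(** The case of Krull's intersection theorem needed here: locally at [P], a
nonzero [u] is divisible by a highest power of [f]. If every quotient
[w] by a power of [f] were again divisible by [f], then for large [N] the
quotient by f^(N+1), multiplied by f^N, would be a multiple c u of [u] up to an
element outside [P]; multiplying by [f], some element of the form s - c f with
[s] outside [P] would kill [u], although s - c f is outside [P]. *)
Lemma extract_power t f u : {subset rcons t f <= P} -> locally_nonzero t u ->
  exists r x w, [/\ x \notin P, x * u - f ^+ r * w \in ideal_gen t &
                    locally_nonzero (rcons t f) w].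
Proof.
move=> tfP nzu; apply: contrapT => no_w.
have fP : f \in P by apply: tfP; rewrite mem_rcons mem_head.
have divisible r : exists x w, x \notin P /\ x * u - f ^+ r * w \in ideal_gen t.
  elim: r => [|r [x [w [nPx xw]]]].
    by exists 1, u; rewrite idealr1 !mul1r subrr ideal_gen0.
  have [y nPy yw] : exists2 y, y \notin P & y * w \in ideal_gen (rcons t f).
    apply: contrapT => no_y; apply: no_w; exists r, x, w; split=> // y nPy.
    by apply/negP=> yw; apply: no_y; exists y.
  have [a ya] := (ideal_gen_rcons t f _).1 yw.
  exists (y * x), a; split; first exact: prime_notinM.
  have -> : y * x * u - f ^+ r.+1 * a =
      y * (x * u - f ^+ r * w) + f ^+ r * (y * w - a * f) by rewrite exprSr; ring.
  by apply: ideal_genD; apply: ideal_genM.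
have [N unifN] := uniform_power (rcons t u) f.
have [x [w [nPx xw]]] := divisible N.+1.
have [||y nPy yw] := unifN w N.+1 1; first by rewrite idealr1.
  apply/ideal_gen_rcons; exists x; rewrite mul1r -opprB -mulN1r.
  exact: ideal_genM.
have [c yc] := (ideal_gen_rcons t u _).1 yw.
have: (y * x - c * f) * u \in ideal_gen t.
  have -> : (y * x - c * f) * u =
      y * (x * u - f ^+ N.+1 * w) + f * (y * f ^+ N * w - c * u) by rewrite exprSr; ring.
  by apply: ideal_genD; apply: ideal_genM.
apply/negP/nzu; apply/negP => Pyx; case/negP: (prime_notinM nPy nPx).
by rewrite -(subrK (c * f) (y * x)) rpredD // idealMr.
Qed.

(** An expansion in powers of a nonzerodivisor [f] that vanishes has a constant
term divisible by [f]; once this term is known to vanish, [f] can be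
cancelled. *)
Lemma expansion_eq0 t f w M (T : 'I_M -> A) :
    (forall y, f * y \in ideal_gen t -> y \in ideal_gen t) ->
    (forall i, T i * w \in ideal_gen (rcons t f) -> T i = 0) ->
    \sum_(i < M) f ^+ i * T i * w \in ideal_gen t ->
  forall i, T i = 0.
Proof.
move=> regf; elim: M T => [|M IHM] T T0 sumT i; first by case: i.
have sumTE : \sum_(i < M.+1) f ^+ i * T i * w = T ord0 * w +
    f * \sum_(i < M) f ^+ i * T (lift ord0 i) * w.
  rewrite big_ord_recl mul1r mulr_sumr; congr (_ + _).
  by apply: eq_bigr => j _; rewrite exprS !mulrA.
rewrite sumTE in sumT.
have T00 : T ord0 = 0.
  apply: T0; apply/ideal_gen_rcons; exists (- \sum_(i < M) f ^+ i * T (lift ord0 i) * w).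
  by rewrite mulNr opprK [_ * f]mulrC.
case: (unliftP ord0 i) => [j ->|-> //].
apply: (IHM (fun j => T (lift ord0 j))) => [l|]; first exact: T0.
by apply: regf; rewrite T00 mul0r add0r in sumT.
Qed.

Variables (F : fieldType) (phi : {rmorphism F -> A}).

(** Induction on the sequence. Write [u] as [f ^+ r * w] with [w] not divisible by
[f], locally at [P]; as [f] is a nonzerodivisor, a relation for [u] gives one
for [w]. Expanding the relation in powers of [f], the terms free of [f] form a
relation for [w] modulo [f] in the remaining elements, to which the induction
hypothesis applies. *)
Lemma regular_power_products_free N t l u (c : exponents N (size l) -> F) :
    {subset t ++ l <= P} -> locally_nonzero t u ->
    (forall i, (i < size l)%N -> forall y, l`_i * y \in ideal_gen (t ++ take i l) ->
       y \in ideal_gen (t ++ take i l)) ->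
    (\sum_e phi (c e) * power_product l e) * u \in ideal_gen t ->
  forall e, c e = 0.
Proof.
elim: l t u c => [|f l IHl] t u c tlP nzu reg.
  rewrite (bigD1 tt) //= big1 ?addr0 ?mulr1 => [cu|[] //]; case.
  apply: contraTeq cu => nzc; apply: nzu; apply/negP => Pc.
  have := idealMr (phi (c tt)^-1) Pc.
  by rewrite -rmorphM mulVf // rmorph1 idealr1.
have [|r [x [w [nPx xw nzw]]]] := @extract_power t f u _ nzu.
  by move=> y; rewrite mem_rcons inE => yft; apply: tlP; rewrite mem_cat inE orbA [(y \in t) || _]orbC yft.
have regf y : f * y \in ideal_gen t -> y \in ideal_gen t.
  by have := reg 0%N (ltn0Sn _) y; rewrite /= cats0.
move=> sumc.
pose T i := \sum_b phi (c (i, b)) * power_product l b.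
have T0 i : T i * w \in ideal_gen (rcons t f) -> forall b, c (i, b) = 0.
  move=> Tw; apply: (IHl (rcons t f) w) => // [|j ltj y].
    by rewrite cat_rcons.
  by rewrite cat_rcons; apply: (reg j.+1).
suff T_eq0 i : T i = 0.
  by case=> i b; apply: T0; rewrite T_eq0 mul0r ideal_gen0.
apply: (expansion_eq0 (t := t) (f := f) (w := w)) i => // [i /T0 c0|].
  by rewrite /T big1 // => b _; rewrite c0 rmorph0 mul0r.
have regfX q y : f ^+ q * y \in ideal_gen t -> y \in ideal_gen t.
  by elim: q => [|q IHq]; rewrite ?mul1r // exprS -mulrA => /regf.
apply: (regfX r); rewrite -mulr_suml; set Y := \sum_(i < N) _.
have defY : \sum_e phi (c e) * power_product (f :: l) e = Y.
  rewrite /Y (eq_bigr (fun i : 'I_N => \sum_b f ^+ i * (phi (c (i, b)) * power_product l b))).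
    by rewrite pair_bigA; apply: eq_bigr => -[j b] _ /=; rewrite mulrCA.
  by move=> j _; rewrite mulr_sumr.
have -> : f ^+ r * (Y * w) = x * (Y * u) - Y * (x * u - f ^+ r * w) by ring.
by rewrite -defY ideal_genB // ideal_genM.
Qed.

End Ideals.
End RegularSequences.

(** * Setting variables to zero, and counting monomials *)

Section VariableSubstitution.
Import GRing.Theory.
Local Open Scope ring_scope.

Variables (k : fieldType) (n : nat).
Implicit Types (W C : {set 'I_n}) (p q : {mpoly k[n]}) (m : 'X_{1..n}).

Definition kill W : {mpoly k[n]} -> {mpoly k[n]} :=
  comp_mpoly [tuple if i \in W then 0 else 'X_i | i < n].

HB.instance Definition _ W := GRing.RMorphism.copy (kill W)
  (comp_mpoly [tuple if i \in W then 0 else 'X_i | i < n]).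

Definition avoids W m := [forall i in W, m i == 0%N].

Lemma kill_monomial W m : kill W 'X_[m] = if avoids W m then 'X_[m] else 0.
Proof.
rewrite /kill comp_mpolyX; case: ifPn => [/forall_inP avm|].
  rewrite mpolyXE_id; apply: eq_bigr => i _; rewrite tnth_mktuple.
  by case: ifP => // /avm/eqP ->; rewrite !expr0.
rewrite negb_forall_in => /exists_inP[i iW nzi].
by rewrite (bigD1 i) //= tnth_mktuple iW expr0n (negPf nzi) mul0r.
Qed.

Lemma kill_scale W c p : kill W (c *: p) = c *: kill W p.
Proof. exact: comp_mpolyZ. Qed.

Lemma mcoeff_kill W p m : (kill W p)@_m = if avoids W m then p@_m else 0.
Proof.
have killZ m' : (kill W (p@_m' *: 'X_[m']))@_m =
    p@_m' * (if avoids W m' then 'X_[m'] else 0)@_m.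
  by rewrite kill_scale kill_monomial mcoeffZ.
rewrite [in LHS](mpolyE p) rmorph_sum /= raddf_sum /= (eq_bigr _ (fun m' _ => killZ m')).
case: ifPn => avm.
  rewrite [in RHS](mpolyE p) raddf_sum; apply: eq_bigr => m' _ /=; rewrite mcoeffZ.
  case: ifPn => // avm'; rewrite mcoeff0 mcoeffX; case: eqP avm' => // ->.
  by rewrite avm.
rewrite big1 // => m' _; case: ifPn => [avm'|_]; last by rewrite mcoeff0 mulr0.
by rewrite mcoeffX; case: eqP avm => [<-|]; rewrite ?avm' ?mulr0.
Qed.

Lemma kill_comp W C p : W \subset C -> kill C (kill W p) = kill C p.
Proof.
move=> sWC; apply/mpolyP=> m; rewrite !mcoeff_kill; case: ifP => // /forall_inP avC.
by rewrite ifT //; apply/forall_inP=> i /(subsetP sWC)/avC.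
Qed.

Lemma kill_face_monomial W (H : {set 'I_n}) :
  kill W (face_monomial k H) = if [disjoint H & W] then face_monomial k H else 0.
Proof.
rewrite /face_monomial rmorph_prod /=.
have killX i : kill W 'X_i = if i \in W then 0 else 'X_i.
  by rewrite /kill comp_mpolyXU -tnth_nth tnth_mktuple.
case: ifPn => [dHW|].
  by apply: eq_bigr => i iH; rewrite killX (disjointFr dHW iH).
rewrite disjoint_subset => /subsetPn[i iH]; rewrite inE negbK => iW.
by rewrite (bigD1 i) //= killX iW mul0r.
Qed.

Lemma face_monomial_neq0 (H : {set 'I_n}) : face_monomial k H != 0.
Proof. by apply/prodf_neq0=> i _; rewrite -msize_poly_eq0 msizeX. Qed.

Lemma msizeM_bound b c p q :
  (msize p <= b.+1)%N -> (msize q <= c.+1)%N -> (msize (p * q) <= (b + c).+1)%N.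
Proof.
have [->|nzp] := eqVneq p 0; first by rewrite mul0r msize0.
have [->|nzq] := eqVneq q 0; first by rewrite mulr0 msize0.
move=> lep leq; rewrite msizeM // -ltnS prednK ?ltnS.
  by apply: leq_trans (leq_add lep leq) _; rewrite addSn addnS.
by rewrite addn_gt0 lt0n msize_poly_eq0 nzp.
Qed.

Lemma msizeX_bound b p r : (msize p <= b.+1)%N -> (msize (p ^+ r) <= (r * b).+1)%N.
Proof.
move=> lep; elim: r => [|r IHr]; first by rewrite expr0 msize1.
by rewrite exprS mulSn; apply: msizeM_bound.
Qed.

Lemma msize_power_product N d b (s : seq {mpoly k[n]}) (e : exponents N d) :
    (forall p, p \in s -> (msize p <= b.+1)%N) ->
  (msize (power_product s e) <= (d * (N * b)).+1)%N.
Proof.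
elim: d s e => [|d IHd] s e sb /=; first by rewrite msize1.
rewrite mulSn; apply: msizeM_bound.
  apply: leq_trans (_ : (e.1 * b).+1 <= _)%N.
    by apply: msizeX_bound; case: s sb => [|p s] sb /=; rewrite ?msize0 ?sb ?mem_head.
  by rewrite ltnS leq_mul2r ltnW ?orbT.
by apply: IHd => p ps; apply: sb; case: s ps => // q s ps; rewrite inE ps orbT.
Qed.

Lemma linear_dependence (T : finType) (X : finType) (M : T -> X -> k) :
    (#|X| < #|T|)%N ->
  exists c : T -> k, (exists e, c e != 0) /\ forall x, \sum_e c e * M e x = 0.
Proof.
move=> ltXT; pose A := \matrix_(i < #|T|, j < #|X|) M (enum_val i) (enum_val j).
have /rowV0Pn[v /sub_kermxP vA nzv] : kermx A != 0.
  rewrite -mxrank_eq0 mxrank_ker subn_eq0 -ltnNge.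
  exact: leq_ltn_trans (rank_leq_col A) ltXT.
exists (fun e => v 0 (enum_rank e)); split.
  have /existsP[j nzj] : [exists j, v 0 j != 0].
    apply: contraNT nzv => /existsPn v0; apply/eqP/rowP=> j.
    by have := v0 j; rewrite negbK mxE => /eqP.
  by exists (enum_val j); rewrite enum_valK.
move=> x; have := congr1 (fun B : 'rV_ _ => B 0 (enum_rank x)) vA; rewrite !mxE.
move=> sum0; rewrite -[RHS]sum0 (reindex (@enum_val T T)) /=.
  by apply: eq_bigr => i _; rewrite enum_valK mxE enum_rankK.
by apply: onW_bij; apply: enum_val_bij.
Qed.

Lemma card_exponents N d : #|exponents N d| = (N ^ d)%N.
Proof. by elim: d => [|d IHd] /=; rewrite ?card_unit // card_prod card_ord IHd expnS. Qed.

(** The right-hand side has degree [d] in [N] and the left-hand side degree [r]: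
with a = d b + 1 the left-hand side is at most (N a)^r, so any [N] above a^r
will do. *)
Lemma exp_growth d r b : (r < d)%N -> exists N, ((d * (N * b)).+1 ^ r < N ^ d)%N.
Proof.
move=> ltrd; pose a := (d * b).+1; exists (a ^ r).+1; set N := (a ^ r).+1.
apply: leq_ltn_trans (_ : (N * a) ^ r < _)%N.
  have: ((d * (N * b)).+1 <= N * a)%N by rewrite /a mulnS mulnCA -addn1 addnC leq_add2r.
  by case: r @N ltrd => // r N _; rewrite leq_exp2r.
rewrite expnMn; apply: leq_trans (_ : N ^ r.+1 <= _)%N; last by rewrite leq_pexp2l.
by rewrite expnSr ltn_pmul2l ?expn_gt0.
Qed.

(** More polynomials than variables are algebraically dependent: their power
products with exponents below [N] outnumber, for large [N], the monomials that
can occur in them. *)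
Lemma power_products_dependent W (s : seq {mpoly k[n]}) :
    (#|~: W| < size s)%N ->
  exists N (c : exponents N (size s) -> k), (exists e, c e != 0) /\
    kill W (\sum_e (c e)%:MP * power_product s e) = 0.
Proof.
move=> ltWs; pose b := \max_(p <- map (kill W) s) msize p.
have [N ltN] := exp_growth b ltWs; set Q := (size s * (N * b))%N in ltN.
(* The monomials without variables of [W] and with exponents at most [Q], which
   bounds the degrees of all the power products. *)
pose X := {f : {ffun 'I_n -> 'I_Q.+1} | f \in pffun_on ord0 (~: W) predT}.
pose mon (x : X) := [multinom val x i : nat | i < n].
pose M (e : exponents N (size s)) (x : X) := (power_product (map (kill W) s) e)@_(mon x).
have [|c [nzc sumc]] := @linear_dependence _ X M.
  by rewrite card_exponents card_sig card_pffun_on card_ord.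
exists N, c; split=> //; apply/mpolyP=> m; rewrite mcoeff0 rmorph_sum raddf_sum /=.
transitivity (\sum_e c e * (power_product (map (kill W) s) e)@_m).
  apply: eq_bigr => e _; rewrite rmorphM /= rmorph_power_product.
  by rewrite /kill comp_mpolyC mul_mpolyC mcoeffZ.
have [/existsP[i /andP[iW nzi]]|] := boolP [exists i, (i \in W) && (m i != 0%N)].
  rewrite big1 // => e _; rewrite [_@__](_ : _ = 0) ?mulr0 //.
  rewrite -rmorph_power_product mcoeff_kill ifN //.
  by rewrite negb_forall_in; apply/exists_inP; exists i.
rewrite negb_exists => /forallP avm.
have [leQ|ltQ] := leqP (mdeg m) Q; last first.
  rewrite big1 // => e _; rewrite [_@__](_ : _ = 0) ?mulr0 //.
  apply/memN_msupp_eq0/msize_mdeg_ge; apply: leq_trans ltQ.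
  apply: msize_power_product => p ps.
  by apply: leqW; apply: (leq_bigmax_seq _ ps).
have leQi i : (m i <= Q)%N.
  by apply: leq_trans leQ; rewrite mdegE (bigD1 i) //= leq_addr.
pose f := [ffun i => inord (m i) : 'I_Q.+1].
have fX : f \in pffun_on ord0 (~: W) predT.
  apply/pffun_onP; split=> //; apply/subsetP=> i; rewrite !inE ffunE.
  apply: contraNN => iW; have := avm i; rewrite iW negbK => /eqP ->.
  by apply/eqP/val_inj; rewrite /= inordK.
have <- : mon (exist _ f fX) = m.
  by apply/mnmP=> i; rewrite mnmE /= ffunE inordK ?ltnS.
exact: sumc.
Qed.

End VariableSubstitution.

(** * Depth and height in the facet ring *)

Section FacetRing.
Import GRing.Theory.
Local Open Scope ring_scope.
Local Open Scope quotient_scope.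

Variables (k : fieldType) (n : nat) (D : {set {set 'I_n}}) (hv : has_vertex D).
Implicit Types (W F G H : {set 'I_n}) (p q : {mpoly k[n]}).

Local Notation I := (facet_idealr k hv).
Local Notation A := (facet_ring k hv).

Definition facet_pi p : A := \pi_({ideal_quot I}) p.

Lemma facet_pi_zmod_morphism : zmod_morphism facet_pi.
Proof. by move=> p q; rewrite /facet_pi !piE. Qed.

Lemma facet_pi_monoid_morphism : monoid_morphism facet_pi.
Proof. by split=> [|p q]; rewrite /facet_pi !piE. Qed.

HB.instance Definition _ :=
  GRing.isZmodMorphism.Build _ _ facet_pi facet_pi_zmod_morphism.
HB.instance Definition _ :=
  GRing.isMonoidMorphism.Build _ _ facet_pi facet_pi_monoid_morphism.

Definition facet_repr (a : A) : {mpoly k[n]} := repr (a : {ideal_quot I}).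

Lemma facet_reprK : cancel facet_repr facet_pi.
Proof. by move=> a; rewrite /facet_pi /facet_repr reprK. Qed.

Lemma facet_pi_eq0 p : (facet_pi p == 0) = (p \in facet_ideal k D).
Proof.
by rewrite -(rmorph0 facet_pi) -[p in RHS]subr0; apply/esym/(Quotient.idealrBE I).
Qed.

Definition meets_facets W := [forall G in facets D, ~~ [disjoint G & W]].

Lemma kill_facet_ideal W p :
  meets_facets W -> p \in facet_ideal k D -> kill W p = 0.
Proof.
move=> /forall_inP meetW; move: p.
apply: ideal_gen_ind => [|x y x0 y0|a x /mapP[G]]; first exact: rmorph0.
  by rewrite rmorphD /= x0 y0 addr0.
by rewrite mem_enum => /meetW nd ->; rewrite rmorphM /= kill_face_monomial (negPf nd) mulr0.
Qed.

(** If [F] contains no facet, setting the variables outside [F] to zero kills the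
ideal but not the monomial of [F]. *)
Lemma face_monomial_in_facet_ideal F :
  (face_monomial k F \in facet_ideal k D) = [exists G in facets D, G \subset F].
Proof.
apply/idP/exists_inP => [Fin|[G GD sGF]].
  apply/exists_inP; apply: contraTT Fin => /exists_inPn noG; apply/negP.
  move/(@kill_facet_ideal (~: F)); rewrite kill_face_monomial.
  rewrite disjoints_subset setCK subxx => Fin; move/eqP: (face_monomial_neq0 k F).
  apply; apply: Fin; apply/forall_inP=> G /noG.
  by rewrite disjoints_subset setCK.
rewrite /face_monomial (big_setID G) /= (setIidPr sGF) mulrC; apply: ideal_genM.
by apply: mem_ideal_gen; apply: map_f; rewrite mem_enum.
Qed.

Lemma nonface_independent : nonface_complex (facet_ideal k D) = independent (facets D).
Proof.
by apply/setP=> F; rewrite !inE face_monomial_in_facet_ideal negb_exists_in.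
Qed.

(** When [W] meets all facets, this is the prime generated by the variables of
[W]: the kernel of the substitution, which then factors through the quotient. *)
Definition variable_prime W : {pred A} := [pred a | kill W (facet_repr a) == 0].

Lemma mem_variable_prime W p :
  meets_facets W -> (facet_pi p \in variable_prime W) = (kill W p == 0).
Proof.
move=> meetW; rewrite inE -[in RHS](subrK (facet_repr (facet_pi p)) p) rmorphD /=.
rewrite [X in X + _](kill_facet_ideal meetW) ?add0r //.
by rewrite -facet_pi_eq0 rmorphB /= facet_reprK subrr.
Qed.

Lemma variable_prime_idealr W : meets_facets W -> idealr_closed (variable_prime W).
Proof.
move=> meetW; split=> [||a x y].
- by rewrite -(rmorph0 facet_pi) mem_variable_prime // rmorph0.
- by rewrite -(rmorph1 facet_pi) mem_variable_prime // rmorph1 oner_eq0.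
rewrite -[a]facet_reprK -[x]facet_reprK -[y]facet_reprK -rmorphM -rmorphD.
rewrite !mem_variable_prime // rmorphD rmorphM /= => /eqP -> /eqP ->.
by rewrite mulr0 addr0.
Qed.

Lemma variable_prime_closed W :
  meets_facets W -> prime_idealr_closed (variable_prime W).
Proof.
move=> meetW x y; rewrite -[x]facet_reprK -[y]facet_reprK -rmorphM.
by rewrite !mem_variable_prime // rmorphM mulf_eq0.
Qed.

Definition variable_prime_of W (meetW : meets_facets W) : prime_idealr A :=
  HB.pack (variable_prime W : A -> bool)
    (isIdealr.Build A (variable_prime W) (variable_prime_idealr meetW))
    (isPrimeIdealrClosed.Build A (variable_prime W) (variable_prime_closed meetW)).

Lemma mem_variable_prime_of W (meetW : meets_facets W) p :
  (facet_pi p \in variable_prime_of meetW) = (kill W p == 0).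
Proof. exact: mem_variable_prime. Qed.

(** Modulo this prime an element is congruent to its constant term, which is a
unit unless it is zero. *)
Lemma variable_prime_maximal (meetT : meets_facets setT) :
  maximal_ideal (variable_prime_of meetT).
Proof.
move=> J sPJ a aJ; set q := kill setT (facet_repr a).
have qC : q = (q@_0%MM)%:MP.
  apply/mpolyP=> m; rewrite mcoeffC mcoeff_kill; case: ifPn => [/forall_inP m0|].
    have -> : m = 0%MM by apply/mnmP=> i; rewrite mnm0E; apply/eqP/m0; rewrite inE.
    rewrite eqxx mulr1 mcoeff_kill ifT //.
    by apply/forall_inP=> i _; rewrite mnm0E.
  case: eqP => [->|_ _]; last by rewrite mulr0.
  by case/negP; apply/forall_inP=> i _; rewrite mnm0E.
have qJ : facet_pi q \in J.
  rewrite -(subrK a (facet_pi q)) rpredD //; apply: sPJ.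
  rewrite -[a]facet_reprK -rmorphB.
  by rewrite mem_variable_prime_of rmorphB /= /q kill_comp // subrr.
rewrite -[a]facet_reprK mem_variable_prime_of -/q; apply: contraTT isT => nzq.
have nzc : q@_0%MM != 0 by apply: contraNneq nzq => q0; rewrite qC q0 mpolyC0.
have := idealMr (facet_pi (q@_0%MM)^-1%:MP) qJ.
by rewrite -rmorphM [q in _ * q]qC -mpolyCM mulVf // rmorph1 idealr1.
Qed.

Lemma meets_facetsS W W' : W \subset W' -> meets_facets W -> meets_facets W'.
Proof.
move=> sWW' /forall_inP meetW; apply/forall_inP=> G /meetW; apply: contraNN.
exact: disjointWr.
Qed.

Lemma meets_facets_compl H :
  H \in independent (facets D) -> meets_facets (~: H).
Proof.
move=> /independentP iH; apply/forall_inP=> G /iH; rewrite disjoints_subset setCK.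
by move/negP.
Qed.

(** Starting from the variables outside [H], the variables of [H] are added one at
a time. *)
Lemma variable_prime_chain H (meetT : meets_facets setT) :
    H \in independent (facets D) ->
  prime_chain_to (variable_prime_of meetT) #|H|.
Proof.
move=> /meets_facets_compl meetC.
pose W i := [set x | (x \notin H) || (index x (enum H) < i)%N].
have meetW i : meets_facets (W i).
  by apply: meets_facetsS meetC; apply/subsetP=> x; rewrite !inE => ->.
have sW i j : (i <= j)%N -> W i \subset W j.
  move=> leij; apply/subsetP=> x; rewrite !inE => /orP[->//|ltxi].
  by rewrite (leq_trans ltxi leij) orbT.
exists (fun i => variable_prime_of (meetW i)); split=> [i lti|a]; last first.
  rewrite -[a]facet_reprK !mem_variable_prime_of; congr (kill _ _ == 0).
  apply/setP=> x; rewrite !inE; case: (boolP (x \in H)) => //= xH.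
  by rewrite cardE index_mem mem_enum.
split=> [a|sub].
  rewrite -[a]facet_reprK !mem_variable_prime_of => /eqP k0.
  by rewrite -(kill_comp _ (sW _ _ (leqnSn i))) k0 rmorph0.
have [x xH ix] : exists2 x, x \in H & index x (enum H) = i.
  have /card_gt0P[x0 x0H] := leq_ltn_trans (leq0n i) lti.
  rewrite cardE in lti; exists (nth x0 (enum H) i); last by rewrite index_uniq ?enum_uniq.
  by rewrite -mem_enum mem_nth.
have := sub (facet_pi (face_monomial k [set x])).
rewrite !mem_variable_prime_of !kill_face_monomial !disjoints1 !inE xH ix ltnn ltnSn.
by rewrite eqxx (negPf (face_monomial_neq0 _ _)) => /(_ isT).
Qed.

(** Each monomial of [p] contains a variable outside [H], and by maximality of
[H] the monomial of [H] times such a variable is in the facet ideal. *)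
Lemma killed_annihilated H p :
    H \in facets (nonface_complex (facet_ideal k D)) ->
  kill (~: H) p = 0 -> p * face_monomial k H \in facet_ideal k D.
Proof.
rewrite inE => /maxsetP[_ maxH] killp.
rewrite [p]mpolyE mulr_suml; apply: (rpred_sum (S := I)) => /= m _.
have [avm|] := boolP (avoids (~: H) m).
  have := congr1 (mcoeff m) killp; rewrite mcoeff_kill avm mcoeff0 => ->.
  by rewrite scale0r mul0r ideal_gen0.
rewrite negb_forall_in => /exists_inP[i]; rewrite inE => inH nzi.
have -> : 'X_[m] = 'X_[m - U_(i)] * 'X_i :> {mpoly k[n]}.
  rewrite -mpolyXD submK //; apply/mnm_lepP=> j; rewrite mnm1E.
  by case: eqP => // <-; rewrite lt0n.
rewrite -mul_mpolyC -!mulrA.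
have -> : 'X_i * face_monomial k H = face_monomial k (i |: H).
  by rewrite /face_monomial big_setU1.
apply: ideal_genM; apply: ideal_genM; apply: contraNT inH => iHN.
have <- := maxH (i |: H); rewrite ?setU11 ?subsetUr //.
by rewrite inE.
Qed.

(** A nontrivial relation modulo the variables outside [H], which exists if [d]
exceeds the number of variables in [H], would become, after multiplication by
the monomial of [H], a relation in the facet ring. *)
Lemma depth_bound H (meetT : meets_facets setT) d :
    noetherian A -> H \in facets (nonface_complex (facet_ideal k D)) ->
  regular_seq_in (variable_prime_of meetT) d -> (d <= #|H|)%N.
Proof.
move=> noethA facetH [s [<- sP [_ regs]]]; rewrite leqNgt; apply/negP => ltHs.
have meetC : meets_facets (~: H).
  by apply: meets_facets_compl; rewrite -nonface_independent; move: facetH; rewrite inE => /maxsetP[].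
pose g := map facet_repr s.
have [|N] := @power_products_dependent k n (~: H) g; first by rewrite setCK size_map.
rewrite size_map => -[c [[e nzc] killc]].
pose phi : {rmorphism k -> A} := facet_pi \o (@mpolyC n k).
case/eqP: nzc; apply: (@regular_power_products_free A (variable_prime_of meetT) noethA
   k phi N [::] s (facet_pi (face_monomial k H)) c sP).
- move=> x nPx; apply/negP => /asboolP[b]; rewrite big_ord0 -[x]facet_reprK -rmorphM => /eqP.
  rewrite facet_pi_eq0 => /(kill_facet_ideal meetC); rewrite rmorphM /= => /eqP.
  rewrite kill_face_monomial disjoints_subset setCK subxx mulf_eq0.
  rewrite (negPf (face_monomial_neq0 _ _)) orbF => /eqP kill0.
  case/negP: nPx; rewrite -[x]facet_reprK mem_variable_prime_of.
  by rewrite -(kill_comp _ (subsetT (~: H))) kill0 rmorph0.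
- by move=> i lti y; rewrite cat0s; apply: regs.
have /(killed_annihilated facetH) := killc; rewrite -facet_pi_eq0 rmorphM rmorph_sum /=.
move/eqP => sum0.
rewrite (_ : _ * _ = 0) ?ideal_gen0 // -[RHS]sum0; congr (_ * _).
apply: eq_bigr => e' _; rewrite rmorphM /= rmorph_power_product /g -map_comp.
by rewrite (eq_map (g := id)) ?map_id //; apply: facet_reprK.
Qed.

Lemma cohen_macaulay_pure F G : cohen_macaulay A ->
    F \in facets (nonface_complex (facet_ideal k D)) ->
    G \in facets (nonface_complex (facet_ideal k D)) ->
  #|F| = #|G|.
Proof.
case=> noethA cmA.
have meetT H : H \in facets (nonface_complex (facet_ideal k D)) -> meets_facets setT.
  rewrite nonface_independent inE => /maxsetP[/meets_facets_compl meetC _].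
  exact: meets_facetsS (subsetT _) meetC.
move=> facetF facetG; have mT := meetT F facetF.
have [d [[regd _] [_ htd]]] := cmA _ (variable_prime_maximal (meetT := mT)).
have eqd H : H \in facets (nonface_complex (facet_ideal k D)) -> d = #|H|.
  move=> facetH; apply/eqP; rewrite eqn_leq (depth_bound noethA facetH regd) /=.
  apply/htd/variable_prime_chain; rewrite -nonface_independent.
  by move: facetH; rewrite inE => /maxsetP[].
by rewrite -(eqd F) // -(eqd G).
Qed.

End FacetRing.

Theorem corollary5p9 (k : fieldType) (n : nat) (D : {set {set 'I_n}})
    (hv : has_vertex D) (htree : simplicial_tree D)
    (hCM : cohen_macaulay (facet_ring k hv)) :
  shellable (nonface_complex (facet_ideal k D)).
Proof.
have [s [us ms shs]] := leafy_shelling (leafy_facets htree).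
rewrite -(nonface_independent k) in ms.
apply: shellable_of_shelling us ms shs => F G.
exact: cohen_macaulay_pure hCM.
Qed.
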